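(* Let $X$ be a complex Banach space and let $T:\mathbb{R}_{\ge 0}\to\mathcal{L}(X)$ be an individually eventually real analytic function, i.e. for each $x\in X$ there is $t_x\ge 0$ such that the orbit $s\mapsto T(s)x$ is real analytic on $(t_x,\infty)$. If $T$ has the semigroup property, then there exist some $t\ge 0$ and $\theta\in(0,\pi/2]$ such that $T$ extends holomorphically to the sector $S(t,\theta)=\{z\in\mathbb{C} : \operatorname{Re} z>t\text{ and }|\arg(z-t)|<\theta\}$, i.e. there is a holomorphic function $S(t,\theta)\to\mathcal{L}(X)$ which coincides with $T$ on $(t,\infty)$.
   Context: $\mathcal{L}(X)$ is the Banach space of bounded linear operators on $X$ with the operator norm; $\mathbb{R}_{\ge 0}=[0,\infty)$. A function $T:\mathbb{R}_{\ge 0}\to\mathcal{L}(X)$ has the semigroup property if $T(s+t)=T(s)T(t)$ for all $s,t\in\mathbb{R}_{\ge 0}$ (no continuity and no condition on $T(0)$ is assumed). An $X$-valued function $f$ is real analytic on an open set $W\subseteq\mathbb{R}$ if for each $s_0\in W$ there are $r>0$ and a sequence $(x_k)_{k\ge 0}$ in $X$ such that $f(s)=\sum_{k=0}^\infty (s-s_0)^k x_k$ for all $s\in(s_0-r,s_0+r)$. $\arg$ is the principal argument. *)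

(* Defs.v *)
From HB Require Import structures.
From mathcomp Require Import all_boot all_order all_algebra complex.
From mathcomp Require Import all_classical all_reals all_analysis.

Set Implicit Arguments.
Unset Strict Implicit.
Unset Printing Implicit Defensive.
Import Order.TTheory GRing.Theory Num.Theory.
Import numFieldTopology.Exports numFieldNormedType.Exports.

Local Open Scope classical_set_scope.
Local Open Scope complex_scope.
Local Open Scope ring_scope.

HB.instance Definition _ (R : rcfType) := NormedModule.copy R[i] R[i]^o.

Section bounded_operators.
Variables (R : realType) (X : normedModType R[i]).

Definition bounded_linear : {pred X -> X} := fun f =>
  `[< linear f /\ exists M : R[i], forall x, `|f x| <= M * `|x| >].

Lemma bounded_linearP (f : X -> X) : f \in bounded_linear <->
  linear f /\ exists M : R[i], forall x, `|f x| <= M * `|x|.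
Proof. by split=> [/asboolP|?]; [|exact/asboolP]. Qed.

Lemma bounded_linear_submod : submod_closed bounded_linear.
Proof.
split.
  apply/bounded_linearP; split; first by move=> a x y; rewrite scaler0 addr0.
  by exists 0 => x; rewrite normr0 mul0r.
move=> a f g /bounded_linearP[lf [M fM]] /bounded_linearP[lg [N gN]].
apply/bounded_linearP; split.
  move=> b x y /=; rewrite !fctE/= lf lg scalerDr !scalerDr !scalerA.
  by rewrite (mulrC a b) addrACA.
exists (`|a| * M + N) => x; rewrite !fctE/= (le_trans (ler_normD _ _))//.
by rewrite mulrDl lerD// normrZ -mulrA ler_wpM2l.
Qed.

HB.instance Definition _ :=
  GRing.isSubmodClosed.Build _ _ bounded_linear bounded_linear_submod.

Record bounded_op := BoundedOp {
  bounded_op_fun :> X -> X;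
  bounded_op_subproof : bounded_op_fun \in bounded_linear }.

HB.instance Definition _ := [isSub for bounded_op_fun].
HB.instance Definition _ := [Choice of bounded_op by <:].
HB.instance Definition _ := [SubChoice_isSubLmodule of bounded_op by <:].
Implicit Types f g : bounded_op.

Lemma bounded_op_linear f : linear f.
Proof. by have /bounded_linearP[] := bounded_op_subproof f. Qed.

HB.instance Definition _ f :=
  GRing.isLinear.Build _ _ _ _ (bounded_op_fun f) (bounded_op_linear f).

Lemma bounded_op_bounded f : exists M : R[i], forall x, `|f x| <= M * `|x|.
Proof. by have /bounded_linearP[] := bounded_op_subproof f. Qed.

Lemma bounded_opP f g : (forall x, f x = g x) -> f = g.
Proof. by move=> fg; apply/val_inj/funext. Qed.

Lemma bounded_op_addE f g x : (f + g) x = f x + g x.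
Proof. by []. Qed.

Lemma bounded_op_scaleE a f x : (a *: f) x = a *: f x.
Proof. by []. Qed.

Lemma bounded_op_comp_subproof f g :
  (f \o g : X -> X) \in bounded_linear.
Proof.
apply/bounded_linearP; split; first by move=> a x y /=; rewrite !linearP.
have [M fM] := bounded_op_bounded f; have [N gN] := bounded_op_bounded g.
exists (`|M| * N) => x /=; apply: le_trans (fM _) _.
apply: (@le_trans _ _ (`|M| * `|g x|)); last by rewrite -mulrA ler_wpM2l.
have [M0|] := boolP (0 <= M); first by rewrite (ger0_norm M0).
have [->|gx0] := eqVneq (g x) 0; first by rewrite normr0 !mulr0.
have := le_trans (normr_ge0 _) (fM (g x)).
by rewrite pmulr_lge0 ?normr_gt0// => ->.
Qed.

Definition bounded_op_comp f g : bounded_op :=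
  BoundedOp (bounded_op_comp_subproof f g).

(* The norm of X takes its values in the nonnegative real elements of R[i];
   the supremum is taken in R. *)
Definition op_norm f : R[i] :=
  (sup [set complex.Re `|f x| | x in [set x : X | `|x| <= 1]])%:C.

Let reN (x : X) : (complex.Re `|x|)%:C = `|x|.
Proof. exact: RRe_real (normr_real x). Qed.

Let has_sup_norm f :
  has_sup [set complex.Re `|f x| | x in [set x : X | `|x| <= 1]].
Proof.
split; first by exists (complex.Re `|f 0|), 0 => //=; rewrite normr0.
have [M fM] := bounded_op_bounded f.
exists (complex.Re `|M|) => _ [x /= x1 <-].
rewrite -lecR reN (RRe_real (normr_real M)).
have [->|x0] := eqVneq x 0; first by rewrite linear0 normr0.
have M0 : 0 <= M.
  by have := le_trans (normr_ge0 _) (fM x); rewrite pmulr_lge0 ?normr_gt0.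
by rewrite (le_trans (fM x))// (ger0_norm M0) ler_piMr.
Qed.

Lemma op_norm_ge0 f : 0 <= op_norm f.
Proof.
rewrite ler0c; apply: ub_le_sup; first by have [] := has_sup_norm f.
by exists 0 => /=; rewrite ?linear0 normr0.
Qed.

Lemma ler_op_norm f x : `|f x| <= op_norm f * `|x|.
Proof.
have [->|x0] := eqVneq x 0; first by rewrite linear0 normr0 mulr0.
have nx0 : 0 < `|x| by rewrite normr_gt0.
rewrite -ler_pdivrMr// mulrC -[X in X * _]ger0_norm ?invr_ge0// -normrZ.
rewrite -linearZ -(reN (f _)) lecR; apply: ub_le_sup.
  by have [] := has_sup_norm f.
exists (`|x|^-1 *: x) => //=.
by rewrite normrZ normfV normr_id mulVf ?gt_eqF.
Qed.

Lemma op_norm_le f (M : R[i]) : 0 <= M ->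
  (forall x, `|f x| <= M * `|x|) -> op_norm f <= M.
Proof.
move=> M0 fM; rewrite /op_norm -(RRe_real (ger0_real M0)) lecR.
apply: ge_sup; first by have [] := has_sup_norm f.
move=> _ [x /= x1 <-]; rewrite -lecR reN (RRe_real (ger0_real M0)).
by rewrite (le_trans (fM x))// ler_piMr.
Qed.

Let op_normD f g : op_norm (f + g) <= op_norm f + op_norm g.
Proof.
apply: op_norm_le => [|x]; first by rewrite addr_ge0 ?op_norm_ge0.
rewrite (le_trans (ler_normD _ _))// mulrDl.
by rewrite lerD ?ler_op_norm.
Qed.

Let op_normZ_le a f : op_norm (a *: f) <= `|a| * op_norm f.
Proof.
apply: op_norm_le => [|x]; first by rewrite mulr_ge0 ?op_norm_ge0.
by rewrite bounded_op_scaleE normrZ -mulrA ler_wpM2l ?ler_op_norm.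
Qed.

Let op_normZ (a : R[i]) f : op_norm (a *: f) = `|a| * op_norm f.
Proof.
apply/le_anti; rewrite op_normZ_le/=.
have [->|a0] := eqVneq a 0; first by rewrite normr0 mul0r op_norm_ge0.
rewrite -ler_pdivlMl ?normr_gt0//.
rewrite -[f in leLHS](scalerK a0) -normfV; exact: op_normZ_le.
Qed.

Let op_norm0_eq0 f : op_norm f = 0 -> f = 0.
Proof.
move=> f0; apply: bounded_opP => x; apply/eqP.
by rewrite -normr_le0 (le_trans (ler_op_norm f x))// f0 mul0r.
Qed.

HB.instance Definition _ := Lmodule_isNormed.Build R[i] bounded_op
  op_normD op_normZ op_norm0_eq0.

Lemma bounded_op_normE f : `|f| = op_norm f.
Proof. by []. Qed.

End bounded_operators.

Section analyticity.
Variables (R : realType) (X : normedModType R[i]).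

Definition real_analytic_on (W : set R) (f : R -> X) :=
  forall s0, W s0 -> exists2 r : R, 0 < r & exists a : X^nat,
    forall s, s \in `](s0 - r), (s0 + r)[ ->
      series (fun k => ((s - s0) ^+ k)%:C *: a k) @ \oo --> f s.

(* T : R -> bounded_op X represents a function on [0, +oo[: as tx >= 0 and the
   radius r in real_analytic_on may be shrunk, the predicates below do not
   depend on the values of T at negative reals. *)
Definition individually_eventually_real_analytic (T : R -> bounded_op X) :=
  forall x : X, exists2 tx : R, 0 <= tx &
    real_analytic_on `]tx, +oo[ (fun s => T s x).

Definition semigroup_property (T : R -> bounded_op X) :=
  forall s t, 0 <= s -> 0 <= t -> T (s + t) = bounded_op_comp (T s) (T t).

Definition holomorphic_on (S : set R[i]) (F : R[i] -> X) :=
  forall z, S z -> derivable F z 1.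

End analyticity.

Section sector.
Variable R : realType.

(* Principal argument, with values in ]-pi, pi]; carg 0 is a junk value. *)
Definition carg (z : R[i]) : R :=
  let c := acos (complex.Re z / complex.Re `|z|) in
  if 0 <= complex.Im z then c else - c.

Lemma cargP (z : R[i]) : z != 0 ->
  [/\ - pi < carg z, carg z <= pi &
      z = `|z| * (cos (carg z) +i* sin (carg z))].
Proof.
case: z => a b z0; rewrite /carg normc_def /=.
set r := Num.sqrt _.
have r2 : r ^+ 2 = a ^+ 2 + b ^+ 2 by rewrite sqr_sqrtr// addr_ge0 ?sqr_ge0.
have r0 : 0 < r.
  rewrite sqrtr_gt0 lt_neqAle addr_ge0 ?sqr_ge0// andbT eq_sym.
  apply: contra z0; rewrite paddr_eq0 ?sqr_ge0// !sqrf_eq0.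
  by move=> /andP[/eqP -> /eqP ->].
have ar1 : (a / r) ^+ 2 + (b / r) ^+ 2 = 1.
  by rewrite !exprMn -mulrDl -r2 exprVn mulfV// sqrf_eq0 gt_eqF.
have arN1 : -1 <= a / r <= 1.
  by rewrite -ler_norml -[1]sqrtr1 -ar1 -sqrtr_sqr ler_sqrt ?addr_ge0 ?sqr_ge0// lerDl sqr_ge0.
have sc : sin (acos (a / r)) = `|b / r|.
  by rewrite sin_acos// -ar1 addrAC subrr add0r sqrtr_sqr.
have cc : cos (acos (a / r)) = a / r by rewrite acosK// in_itv.
have rC (x y : R) : r%:C * (x +i* y) = (r * x) +i* (r * y).
  by apply/eqP; rewrite eq_complex /= !mul0r subr0 addr0 !eqxx.
have rK x : r * (x / r) = x by rewrite mulrC divfK ?gt_eqF.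
case: ifPn => b0; split.
- by rewrite (lt_le_trans _ (acos_ge0 arN1))// oppr_lt0 pi_gt0.
- exact: acos_lepi.
- by rewrite rC cc sc ger0_norm ?rK// divr_ge0// ltW.
- rewrite ltrN2 acos_ltpi//; case/andP: arN1 => + ->; rewrite andbT le_eqVlt.
  case/orP => // /eqP a1; move: ar1; rewrite -a1 sqrrN expr1n => /eqP.
  rewrite eq_sym addrC -subr_eq subrr eq_sym sqrf_eq0 mulf_eq0 invr_eq0.
  by rewrite (gt_eqF r0) orbF => /eqP b00; rewrite b00 lexx in b0.
- by rewrite (@le_trans _ _ 0) ?pi_ge0// oppr_le0 acos_ge0.
- rewrite rC cosN sinN cc sc ler0_norm ?opprK ?rK//.
  by rewrite pmulr_lle0 ?invr_gt0// ltW// ltNge.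
Qed.

Definition sector (t theta : R) : set R[i] :=
  [set z | t < complex.Re z /\ `|carg (z - t%:C)| < theta].

End sector.

(* Main.v *)
Require Import Defs.
From mathcomp Require Import all_boot all_order all_algebra complex.
From mathcomp Require Import all_classical all_reals all_analysis.
From mathcomp Require Import ring lra.

Import Order.TTheory GRing.Theory Num.Theory.
Import numFieldTopology.Exports numFieldNormedType.Exports.
Local Open Scope classical_set_scope.
Local Open Scope complex_scope.
Local Open Scope ring_scope.

(** A Baire argument first makes the analyticity uniform in the vector. For
integers [n] and [m], let [A] be the set of vectors [x] whose orbit is, near the time
[a = n + 1], the sum of a power series with coefficients of size at most
[M * r ^- k], where [r = 1 / (m + 1)] and [M = m + 1]. These countably many sets
cover the space. Each is closed: by [coef_small], the coefficients depend
continuously on the vector, uniformly over a family with a common geometric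
bound, even though nothing is known about the boundedness of [s |-> T s]. One of
the sets therefore contains a ball, and by linearity the orbit of every vector
expands at [a] with a common radius [r], with bounds proportional to the norm of
the vector and hence with bounded operators as coefficients
([uniform_expansion], [expandable_coef]).

The semigroup law then spreads the expansion and enlarges its radius in
proportion to the time. As [T (k * (a + s))] is the [k]-th power of
[T (a + s)], its power series in [s] still has radius [r]; in terms of the total
displacement [k * s] the radius is [k * r]. Every time [t > a] follows a
multiple [k * a] by less than [a], and composing with the fixed operator
[T (t - k * a)] preserves the radius, so that the expansion at [t] has radius at
least [rho t = (t - a) / a * r] ([expandable_at]). Coefficients are measured by
[\sum_k |b k| r^k] because this quantity is submultiplicative at a fixed radius.

Let [B t k] be the coefficients at [t], and put
[F (t + i y) = \sum_k (i y)^k B t k]. This makes sense for [|y| <= rho t], which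
contains a sector with vertex [a]. Near a point [t + i y] of the sector [F] is
the sum of the single power series at [t]: recentering that series at [t + s]
gives coefficients which agree with [B (t + s)], since both represent the same
orbit on a real interval ([recenter_real]). Sums of operator power series are
differentiable in the operator norm ([derivable_power_series]). *)

(** * Real-valued norms *)

(** The norm of a complex normed module is a complex number; real inequalities
are easier to handle, in particular by linear arithmetic. *)
Definition rnorm {R : realType} {X : normedModType R[i]} (x : X) : R :=
  complex.Re `|x|.

Section real_norm.
Context {R : realType} {X : normedModType R[i]}.
Implicit Types x y : X.

Lemma rnormE x : (rnorm x)%:C = `|x|.
Proof. by rewrite /rnorm RRe_real ?normr_real. Qed.

Lemma rnorm_ge0 x : 0 <= rnorm x.
Proof. by rewrite -lecR rnormE normr_ge0. Qed.

Lemma rnorm0 : rnorm (0 : X) = 0.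
Proof. by rewrite /rnorm normr0. Qed.

Lemma rnorm_gt0 x : x != 0 -> 0 < rnorm x.
Proof. by rewrite -ltcR rnormE normr_gt0. Qed.

Lemma rnormD x y : rnorm (x + y) <= rnorm x + rnorm y.
Proof. by rewrite -lecR rmorphD/= !rnormE ler_normD. Qed.

Lemma rnormN x : rnorm (- x) = rnorm x.
Proof. by rewrite /rnorm normrN. Qed.

Lemma rnormB x y : rnorm (x - y) = rnorm (y - x).
Proof. by rewrite -rnormN opprB. Qed.

Lemma rnormZ (a : R[i]) x : rnorm (a *: x) = rnorm a * rnorm x.
Proof. by apply: complexI; rewrite rmorphM/= !rnormE normrZ. Qed.

Lemma rnorm_sum I (r : seq I) (P : pred I) (F : I -> X) :
  rnorm (\sum_(i <- r | P i) F i) <= \sum_(i <- r | P i) rnorm (F i).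
Proof.
elim/big_rec2 : _ => [|i y1 y2 Pi le12]; first by rewrite rnorm0.
by rewrite (le_trans (rnormD _ _))// lerD2l.
Qed.

Lemma rnorm_eq0 x : (forall e : R, 0 < e -> rnorm x <= e) -> x = 0.
Proof.
move=> xe; apply/eqP/contraT => /rnorm_gt0 x0.
have := xe _ (divr_gt0 x0 (ltr0Sn R 1)); lra.
Qed.

Lemma cvg_rnormP (u : nat -> X) (l : X) : u @ \oo --> l <->
  forall e : R, 0 < e -> exists N, forall n, (N <= n)%N -> rnorm (u n - l) < e.
Proof.
split=> [/cvgrPdist_lt ul e e0|ul].
  have /ul[N _ Nu] : 0 < e%:C by rewrite ltcR.
  exists N => n Nn; rewrite rnormB.
  by have := Nu n Nn; rewrite -rnormE ltcR.
apply/cvgrPdist_lt => e e0; have re : e \is Num.real by rewrite gtr0_real.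
have Re0 : 0 < complex.Re e by rewrite -ltcR RRe_real.
have [N Nu] := ul _ Re0.
exists N => // n /= Nn; rewrite -rnormE rnormB -(RRe_real re) ltcR; exact: Nu.
Qed.

Lemma rnorm_cvg_le {u : nat -> X} {l : X} {K : R} : u @ \oo --> l ->
  (exists N, forall n, (N <= n)%N -> rnorm (u n) <= K) -> rnorm l <= K.
Proof.
move=> /cvg_rnormP ul [N uK]; apply/ler_addgt0Pr => e e0.
have [M uM] := ul _ e0.
have -> : l = u (maxn N M) - (u (maxn N M) - l) by rewrite subKr.
rewrite (le_trans (rnormD _ _))// lerD ?uK ?leq_maxl// rnormN.
by rewrite ltW// uM// leq_maxr.
Qed.

End real_norm.

Section scalar_norm.
Context {R : realType}.
Implicit Types (a b : R[i]) (x y : R).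

Lemma rnormM a b : rnorm (a * b) = rnorm a * rnorm b.
Proof. by apply: complexI; rewrite rmorphM/= !rnormE normrM. Qed.

Lemma rnorm1 : rnorm (1 : R[i]) = 1.
Proof. by rewrite /rnorm normr1. Qed.

Lemma rnormX a n : rnorm (a ^+ n) = rnorm a ^+ n.
Proof. by elim: n => [|n ih]; rewrite ?rnorm1// !exprS rnormM ih. Qed.

Lemma rnormR x : rnorm x%:C = `|x|.
Proof. by rewrite /rnorm normc_def/= expr0n/= addr0 sqrtr_sqr. Qed.

Lemma rnorm_nat n : rnorm (n%:R : R[i]) = n%:R.
Proof. by rewrite -(rmorph_nat (real_complex R)) rnormR ger0_norm. Qed.

End scalar_norm.

Lemma bounded_nondecreasing_cauchy {R : realType} (S : nat -> R) (K : R) :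
  nondecreasing_seq S -> (forall n, S n <= K) ->
  forall e, 0 < e -> exists N, forall n, S n - S N < e.
Proof.
move=> Sm SK e e0.
have hs : has_sup (range S).
  by split; [exists (S 0%N), 0%N|exists K => _ [n _ <-]].
have [_ [N _ <-] HN] := sup_adherent e0 hs.
exists N => n.
have : S n <= sup (range S) by apply: ub_le_sup; [case: hs|exists n].
lra.
Qed.

(** * Absolutely convergent series *)

Lemma series_norm_le {R : realType} {X : normedModType R[i]} (b : nat -> X)
    (L : X) (K : R) :
  (forall N, \sum_(0 <= k < N) rnorm (b k) <= K) ->
  series b @ \oo --> L -> rnorm L <= K.
Proof.
move=> bK bL; apply: (rnorm_cvg_le bL); exists 0%N => n _.
by rewrite (le_trans _ (bK n))// rnorm_sum.
Qed.

Lemma abs_summable_cvg {R : realType} {X : completeNormedModType R[i]}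
    (b : nat -> X) (K : R) :
  (forall N, \sum_(0 <= k < N) rnorm (b k) <= K) ->
  exists L : X, series b @ \oo --> L.
Proof.
move=> bK; suff : cvg (series b @ \oo) by move/cvg_ex.
apply/cauchy_cvgP/cauchy_exP => e e0.
have re : e \is Num.real by rewrite gtr0_real.
have Re0 : 0 < complex.Re e by rewrite -ltcR RRe_real.
pose S : nat -> R := series (fun k => rnorm (b k)).
have S_incr : nondecreasing_seq S.
  apply/nondecreasing_seqP => n; rewrite /S /series/= big_nat_recr//= lerDl.
  exact: rnorm_ge0.
have [N HN] := bounded_nondecreasing_cauchy _ _ S_incr bK _ Re0.
exists (series b N); exists N => // n /= Nn.
rewrite -ball_normE/= -rnormE rnormB -(RRe_real re) ltcR.
apply: le_lt_trans (HN n).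
rewrite sub_series_geq// [leRHS](@sub_series_geq _ (fun k => rnorm (b k)))//.
exact: rnorm_sum.
Qed.

Lemma triangle_sum {V : nmodType} (u : nat -> nat -> V) N :
  \sum_(0 <= k < N) \sum_(0 <= j < k.+1) u j (k - j)%N =
  \sum_(0 <= j < N) \sum_(0 <= l < N - j) u j l.
Proof.
elim: N => [|N ih]; first by rewrite !big_geq.
rewrite big_nat_recr//= ih [in RHS]big_nat_recr//= subSn// subnn.
rewrite [in LHS]big_nat_recr//= subnn addrA big_nat1 -big_split/=.
congr (_ + _); apply: eq_big_nat => j /andP[_ jN].
by rewrite subSn ?(ltnW jN)// big_nat_recr.
Qed.

(** Both ways of summing a double array, by rows and by diagonals, are compared
through partial sums, so that neither the series of the row sums nor that of the
diagonal sums has to be known to converge beforehand. *)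
Section rearrangement.
Context {R : realType} {X : normedModType R[i]}.
Variables (u : nat -> nat -> X) (K : R) (v : nat -> X).
Let d k := \sum_(0 <= j < k.+1) u j (k - j)%N.
Let S N := \sum_(0 <= j < N) \sum_(0 <= l < N) rnorm (u j l).
Hypothesis uK : forall N, S N <= K.
Hypothesis uv : forall j, series (u j) @ \oo --> v j.

Let sum_u_ge0 a b j : 0 <= \sum_(a <= l < b) rnorm (u j l).
Proof. by apply: sumr_ge0 => l _; exact: rnorm_ge0. Qed.

(** Entries with [j + l >= N] avoid the square of side [p] because
[p.*2 <= N]. *)
Let corner p N M : (p.*2 <= N <= M)%N ->
  \sum_(0 <= j < N) \sum_(N - j <= l < M) rnorm (u j l) <= S M - S p.
Proof.
move=> /andP[pN NM].
have p_le_N : (p <= N)%N by rewrite (leq_trans _ pN)// -addnn leq_addr.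
have pM := leq_trans p_le_N NM.
have -> : S M - S p = \sum_(0 <= j < p) \sum_(p <= l < M) rnorm (u j l) +
    \sum_(p <= j < M) \sum_(0 <= l < M) rnorm (u j l).
  rewrite /S (big_cat_nat _ pM)//= addrAC; congr (_ + _).
  rewrite -sumrB; apply: eq_bigr => j _.
  by rewrite (big_cat_nat _ pM)//= addrAC subrr add0r.
rewrite (big_cat_nat _ p_le_N)//= lerD//.
  rewrite !big_nat; apply: ler_sum => j /andP[_ jp].
  have pNj : (p <= N - j)%N.
    by rewrite leq_subRL ?(leq_trans (ltnW jp))// (leq_trans _ pN)//
      -addnn leq_add2r ltnW.
  rewrite [leRHS](big_cat_nat pNj (leq_trans (leq_subr _ _) NM))/= lerDr.
  exact: sum_u_ge0.
rewrite [leRHS](big_cat_nat p_le_N NM)/=.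
rewrite (le_trans (y := \sum_(p <= j < N) \sum_(0 <= l < M) rnorm (u j l)))//.
  apply: ler_sum => j _.
  rewrite [leRHS](big_cat_nat (leq0n (N - j)) (leq_trans (leq_subr _ _) NM))/=.
  by rewrite lerDr sum_u_ge0.
by rewrite lerDl; apply: sumr_ge0 => j _; exact: sum_u_ge0.
Qed.

(** The [N]-th partial sum of [v] is the limit in [M] of sums over [N]-by-[M]
rectangles, which exceed the triangle summed by [d] only in entries with
[j + l >= N]; these carry little norm in total. *)
Lemma diagonal_cvg (L : X) :
  series v @ \oo --> L <-> series d @ \oo --> L.
Proof.
suff vd : (fun n => series v n - series d n) @ \oo --> (0 : X).
  split=> [vL|dL].
    have -> : series d = series v - (fun n => series v n - series d n).
      by apply/funext => n; rewrite !fctE subKr.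
    by rewrite -[L]subr0; exact: cvgB vL vd.
  have -> : series v = (fun n => series v n - series d n) + series d.
    by apply/funext => n; rewrite !fctE subrK.
  by rewrite -[L]add0r; exact: cvgD vd dL.
apply/cvg_rnormP => e e0.
have S_incr : nondecreasing_seq S.
  apply/nondecreasing_seqP => n; rewrite /S big_nat_recr//= -[leLHS]addr0
    lerD//.
  by apply: ler_sum => j _; rewrite big_nat_recr//= lerDl rnorm_ge0.
have e2 : 0 < e / 2 by lra.
have [p HS] := bounded_nondecreasing_cauchy _ _ S_incr uK _ e2.
exists p.*2 => N pN; rewrite subr0.
suff : rnorm (series v N - series d N) <= e / 2 by lra.
pose w M := \sum_(0 <= j < N) series (u j) M.
have wv : w @ \oo --> series v N.
  rewrite /w /series /=; elim: (N) => [|m ih].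
    rewrite big_geq//; under eq_fun do rewrite big_geq//; exact: cvg_cst.
  rewrite big_nat_recr//=; under eq_fun do rewrite big_nat_recr//=.
  exact: cvgD ih (uv m).
apply: (rnorm_cvg_le (cvgB wv (cvg_cst (series d N)))).
exists N => M NM; rewrite !fctE.
have -> : w M - series d N = \sum_(0 <= j < N) \sum_(N - j <= l < M) u j l.
  rewrite /w /series /d /= triangle_sum -sumrB; apply: eq_bigr => j _.
  by rewrite (big_cat_nat (leq0n (N - j)) (leq_trans (leq_subr _ _) NM))//=
    addrAC subrr add0r.
rewrite (le_trans (rnorm_sum _ _ _ _))//.
apply: le_trans (ltW (HS M)); apply: le_trans (corner p N M _);
  last by rewrite pN.
by apply: ler_sum => j _; exact: rnorm_sum.
Qed.

End rearrangement.

(** * Power series *)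

Definition power_series {R : realType} {X : normedModType R[i]}
    (b : nat -> X) (w : R[i]) : nat -> X :=
  series (fun k => w ^+ k *: b k).

(** The Wiener algebra norm [\sum_k |b k| r^k] is at most [K]. In contrast to a
bound on the individual coefficients, it is submultiplicative for Cauchy
products without any loss in the radius. *)
Definition wiener {R : realType} {X : normedModType R[i]}
    (r K : R) (b : nat -> X) :=
  forall N, \sum_(0 <= k < N) rnorm (b k) * r ^+ k <= K.

Lemma sum_geometric_le {R : realType} (q : R) N P : 0 <= q <= 2^-1 ->
  \sum_(N <= k < P) q ^+ k <= 2 * q ^+ N.
Proof.
move=> /andP[q0 q1]; have [NP|/ltnW PN] := leqP N P; last first.
  by rewrite big_geq// mulr_ge0// exprn_ge0.
suff : \sum_(N <= k < P) q ^+ k <= 2 * q ^+ N - 2 * q ^+ P.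
  by have := exprn_ge0 P q0; lra.
rewrite -(subnKC NP); elim: (P - N)%N => [|p ih].
  by rewrite addn0 big_geq// subrr.
rewrite addnS big_nat_recr ?leq_addr//= exprS.
have : q * q ^+ (N + p) <= 2^-1 * q ^+ (N + p) by rewrite ler_wpM2r// exprn_ge0.
lra.
Qed.

Section power_series.
Context {R : realType} {X : normedModType R[i]}.
Implicit Types (b : nat -> X) (r K M : R) (w v : R[i]).

Lemma wiener_coef r K b k : 0 <= r -> wiener r K b -> rnorm (b k) * r ^+ k <= K.
Proof.
move=> r0 /(_ k.+1); apply: le_trans; rewrite big_nat_recr//= lerDr.
by apply: sumr_ge0 => i _; rewrite mulr_ge0 ?exprn_ge0 ?rnorm_ge0.
Qed.

Lemma coef_bound_ge0 r M b : 0 < r -> (forall k, rnorm (b k) * r ^+ k <= M) ->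
  0 <= M.
Proof.
by move=> r0 /(_ 0%N); apply: le_trans; rewrite expr0 mulr1 rnorm_ge0.
Qed.

Lemma coef_wiener r M b : 0 < r -> (forall k, rnorm (b k) * r ^+ k <= M) ->
  wiener (r / 2) (2 * M) b.
Proof.
move=> r0 bM N.
have M0 : 0 <= M := coef_bound_ge0 _ _ _ r0 bM.
apply: (@le_trans _ _ (\sum_(0 <= k < N) M * 2^-1 ^+ k)).
  apply: ler_sum => k _; rewrite exprMn mulrA ler_wpM2r ?exprn_ge0//.
rewrite -mulr_sumr mulrC ler_wpM2r//.
have := @sum_geometric_le R 2^-1 0 N; rewrite expr0 mulr1; apply.
by rewrite lexx invr_ge0 ler0n.
Qed.

(** On the disc of radius [r / 2] the terms are dominated by a geometric series
of ratio at most [1 / 2]. *)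
Lemma power_series_tail b r M w (L : X) N : 0 < r ->
  (forall k, rnorm (b k) * r ^+ k <= M) -> rnorm w <= r / 2 ->
  power_series b w @ \oo --> L ->
  rnorm (L - power_series b w N) <= 2 * M * (rnorm w / r) ^+ N.
Proof.
move=> r0 bM wr bL.
have M0 : 0 <= M := coef_bound_ge0 _ _ _ r0 bM.
apply: (rnorm_cvg_le (cvgB bL (cvg_cst (power_series b w N)))).
exists N => P NP; rewrite !fctE /power_series sub_series_geq//.
rewrite (le_trans (rnorm_sum _ _ _ _))//.
apply: (@le_trans _ _ (\sum_(N <= k < P) M * (rnorm w / r) ^+ k)).
  apply: ler_sum => k _; rewrite rnormZ rnormX expr_div_n mulrCA ler_wpM2l//.
    by rewrite exprn_ge0// rnorm_ge0.
  by rewrite ler_pdivlMr ?exprn_gt0.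
rewrite -mulr_sumr mulrAC mulrC ler_wpM2r// sum_geometric_le//.
rewrite divr_ge0 ?rnorm_ge0 ?(ltW r0)//= ler_pdivrMr// mulrC; lra.
Qed.

(** A vector [y] of small norm has small coefficients, uniformly over the
expansions with a common bound [M]. No uniformity of [S s] in [s] enters: the
coefficient of index [k] is isolated by evaluating at a single small [s], where
the terms of higher index are of order [s ^ (k + 1)] by the common bound, those
of lower index are small by induction, and [S s y] is small because the single
operator [S s] is bounded. *)
Lemma coef_small (S : R -> bounded_op X) r M k : 0 < r -> forall e, 0 < e ->
  exists2 delta, 0 < delta & forall y b,
    (forall i, rnorm (b i) * r ^+ i <= M) ->
    (forall s, 0 < s <= r / 2 -> power_series b s%:C @ \oo --> S s y) ->
    rnorm y < delta -> rnorm (b k) < e.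
Proof.
move=> r0; suff H : forall n e, 0 < e -> exists2 delta, 0 < delta & forall y b,
    (forall i, rnorm (b i) * r ^+ i <= M) ->
    (forall s, 0 < s <= r / 2 -> power_series b s%:C @ \oo --> S s y) ->
    rnorm y < delta -> forall i, (i < n)%N -> rnorm (b i) < e.
  move=> e /(H k.+1)[d d0 Hd]; exists d => // y b bM bS yd.
  exact: (Hd y b bM bS yd).
elim=> [|n ih] e e0; first by exists 1.
have [d1 d10 Hd1] := ih e e0.
pose M1 := `|M| + 1; have M10 : 0 < M1 by rewrite /M1 ltr_wpDl.
have rn : 0 < r ^+ n.+1 by rewrite exprn_gt0.
(* The third bound makes the tail after [n.+1] terms at most
   [s ^+ n * e / 4]. *)
pose s := Num.min 1 (Num.min (r / 2) (e * r ^+ n.+1 / (8 * M1))).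
have s0 : 0 < s by rewrite /s !lt_min ltr01 divr_gt0// divr_gt0 ?mulr_gt0.
have s1 : s <= 1 by rewrite /s ge_min lexx.
have sr : s <= r / 2 by rewrite /s !ge_min lexx orbT.
have sM : s <= e * r ^+ n.+1 / (8 * M1) by rewrite /s !ge_min lexx !orbT.
have sn : 0 < s ^+ n by rewrite exprn_gt0.
pose e' := s ^+ n * e / 4 / n.+1%:R.
have e'0 : 0 < e' by rewrite !divr_gt0 ?mulr_gt0.
have [d2 d20 Hd2] := ih e' e'0.
pose Ns := rnorm (S s) + 1; have Ns0 : 0 < Ns by rewrite ltr_wpDl// rnorm_ge0.
exists (Num.min d1 (Num.min d2 (s ^+ n * e / (4 * Ns)))).
  by rewrite !lt_min d10 d20 divr_gt0 ?mulr_gt0.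
move=> y b bM bS; rewrite !lt_min => /and3P[yd1 yd2 yd3] i.
rewrite ltnS leq_eqVlt => /predU1P[->{i}|]; last exact: Hd1 bM bS yd1 i.
have small i : (i < n)%N -> rnorm (b i) < e' by exact: Hd2 bM bS yd2 i.
have rs : rnorm s%:C = s by rewrite rnormR gtr0_norm.
have bSs : power_series b s%:C @ \oo --> S s y by apply: bS; rewrite s0.
have tail := @power_series_tail b r M s%:C (S s y) n.+1 r0 bM _ bSs.
rewrite rs in tail; have {}tail := tail sr.
have Sy : rnorm (S s y) <= s ^+ n * e / 4.
  apply: (@le_trans _ _ (Ns * rnorm y)).
    apply: (@le_trans _ _ (rnorm (S s) * rnorm y)).
      by rewrite -lecR rmorphM/= !rnormE; exact: ler_op_norm.
    by rewrite ler_wpM2r ?rnorm_ge0// /Ns lerDl.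
  rewrite mulrC -ler_pdivlMr//; apply: le_trans (ltW yd3) _.
  by rewrite invfM mulrA.
have head : rnorm (power_series b s%:C n) <= s ^+ n * e / 4.
  rewrite /power_series /series/= (le_trans (rnorm_sum _ _ _ _))//.
  apply: (@le_trans _ _ (\sum_(0 <= i < n) e')).
    rewrite !big_nat; apply: ler_sum => i /andP[_ iN].
    rewrite rnormZ rnormX rs -[leRHS]mul1r ler_pM ?exprn_ge0 ?rnorm_ge0//.
        exact: ltW.
      by rewrite exprn_ile1// ltW.
    exact/ltW/small.
  have -> : s ^+ n * e / 4 = e' * n.+1%:R by rewrite /e' divfK.
  by rewrite sumr_const_nat subn0 -[leLHS]mulr_natr ler_wpM2l ?ler_nat// ltW.
have tail_small : 2 * M * (s / r) ^+ n.+1 <= s ^+ n * e / 4.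
  apply: (@le_trans _ _ (2 * M1 * (s / r) ^+ n.+1)).
    rewrite ler_wpM2r ?exprn_ge0 ?divr_ge0 ?(ltW s0) ?(ltW r0)// ler_wpM2l//.
    by rewrite (le_trans (ler_norm _))// /M1 lerDl.
  rewrite expr_div_n exprSr mulrA ler_pdivrMr// mulrCA -!mulrA ler_pM2l//.
  move: sM; rewrite ler_pdivlMr ?mulr_gt0//; lra.
rewrite -(ltr_pM2l sn).
have -> : s ^+ n * rnorm (b n) = rnorm (s%:C ^+ n *: b n).
  by rewrite rnormZ rnormX rs.
have -> : s%:C ^+ n *: b n =
    S s y - power_series b s%:C n - (S s y - power_series b s%:C n.+1).
  rewrite /power_series/series/= big_nat_recr//=.
  by rewrite opprB [RHS]addrC addrA subrK addrAC subrr add0r.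
rewrite (le_lt_trans (rnormD _ _))// rnormN.
have := rnormD (S s y) (- power_series b s%:C n); rewrite rnormN.
have := mulr_gt0 sn e0; lra.
Qed.

(** [coef_small] for the difference of the two sequences, with [S] and [y]
zero. *)
Lemma power_series_unique r M (b c : nat -> X) (f : R -> X) : 0 < r ->
  (forall i, rnorm (b i) * r ^+ i <= M) ->
  (forall i, rnorm (c i) * r ^+ i <= M) ->
  (forall s, 0 < s <= r / 2 -> power_series b s%:C @ \oo --> f s) ->
  (forall s, 0 < s <= r / 2 -> power_series c s%:C @ \oo --> f s) ->
  forall k, b k = c k.
Proof.
move=> r0 bM cM bf cf k.
apply/eqP; rewrite -subr_eq0; apply/eqP/rnorm_eq0 => e e0.
have [d d0] := @coef_small (fun=> 0) r (M + M) k r0 e e0.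
move=> /(_ 0 (b - c)) H; apply/ltW/H => [i|s sr|]; last by rewrite rnorm0.
  rewrite !fctE (le_trans _ (lerD (bM i) (cM i)))//
    -mulrDl ler_wpM2r ?exprn_ge0 ?(ltW r0)//.
  by rewrite (le_trans (rnormD _ _))// rnormN.
have -> : power_series (b - c) s%:C = power_series b s%:C - power_series c s%:C.
  apply/funext => n; rewrite !fctE /power_series /series/= -sumrB.
  by apply: eq_bigr => i _; rewrite scalerBr.
have -> : (0 : bounded_op X) (0 : X) = f s - f s by rewrite subrr.
exact: cvgB (bf s sr) (cf s sr).
Qed.

End power_series.

Lemma square_le_triangle {R : numDomainType} (g : nat -> nat -> R) N :
  (forall j l, 0 <= g j l) ->
  \sum_(0 <= j < N) \sum_(0 <= l < N) g j l <=
  \sum_(0 <= k < N.*2) \sum_(0 <= j < k.+1) g j (k - j)%N.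
Proof.
move=> g0; rewrite triangle_sum -addnn.
rewrite [leRHS](big_cat_nat (leq0n N) (leq_addr _ _))/= -[leLHS]addr0.
apply: lerD; last by apply: sumr_ge0 => j _; exact: sumr_ge0.
rewrite !big_nat; apply: ler_sum => j /andP[_ jN].
have NNj : (N <= N + N - j)%N by rewrite -addnBA ?leq_addr// ltnW.
by rewrite [leRHS](big_cat_nat (leq0n N) NNj)/= lerDl; exact: sumr_ge0.
Qed.

Section complete.
Context {R : realType} {X : completeNormedModType R[i]}.
Implicit Types (b : nat -> X) (r K M : R) (w v : R[i]).

Lemma wiener_cvg r K b w : wiener r K b -> rnorm w <= r ->
  exists2 L : X, power_series b w @ \oo --> L & rnorm L <= K.
Proof.
move=> bK wr.
have bwK N : \sum_(0 <= k < N) rnorm (w ^+ k *: b k) <= K.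
  apply: le_trans (bK N); apply: ler_sum => k _.
  by rewrite rnormZ rnormX mulrC ler_wpM2l ?rnorm_ge0//
    lerXn2r ?nnegrE ?rnorm_ge0 ?(le_trans _ wr) ?rnorm_ge0.
have [L bL] := abs_summable_cvg _ _ bwK.
by exists L => //; exact: series_norm_le bwK bL.
Qed.

(** The expansion of [\sum_k (v + w)^k b_k] in powers of [v]: by the binomial
formula, its terms are the diagonal sums of the double array
['C(j + l, j) v^j w^l b_(j + l)], and the rows sum to [v^j d_j]. The
total norm of the array is at most [\sum_k (|v| + |w|)^k |b_k|]. *)
Lemma recenter r K b w : wiener r K b -> rnorm w < r ->
  exists d : nat -> X,
  [/\ forall j, series (fun l => ('C(j + l, j)%:R * w ^+ l) *: b (j + l)%N)
        @ \oo --> d j,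
      forall j, rnorm (d j) * (r - rnorm w) ^+ j <= K
    & forall v (L : X), rnorm v <= r - rnorm w ->
      power_series d v @ \oo --> L <-> power_series b (v + w) @ \oo --> L].
Proof.
move=> bK wr; set s := r - rnorm w; have s0 : 0 < s by rewrite subr_gt0.
pose c j l : X := ('C(j + l, j)%:R * w ^+ l) *: b (j + l)%N.
pose g j l := s ^+ j * rnorm (c j l).
have g0 j l : 0 <= g j l by rewrite mulr_ge0 ?rnorm_ge0// exprn_ge0// ltW.
have gK N : \sum_(0 <= j < N) \sum_(0 <= l < N) g j l <= K.
  apply: le_trans (square_le_triangle g N g0) _.
  apply: le_trans (bK N.*2); apply: ler_sum => k _.
  have -> : r = rnorm w + s by rewrite /s addrC subrK.
  rewrite exprDn mulr_sumr big_mkord; apply: ler_sum => -[j /=].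
  rewrite ltnS => jk _.
  rewrite /g /c subnKC// rnormZ rnormM rnormX rnorm_nat -mulr_natr.
  by rewrite le_eqVlt; apply/orP; left; apply/eqP; ring.
have row j N : \sum_(0 <= l < N) rnorm (c j l) <= K / s ^+ j.
  rewrite ler_pdivlMr ?exprn_gt0// mulrC mulr_sumr.
  apply: le_trans (gK (maxn j.+1 N)).
  rewrite [leRHS](big_cat_nat (leq0n j.+1) (leq_maxl _ _))/= big_nat_recr//=
    -/(g _ _).
  apply: (@le_trans _ _ (\sum_(0 <= l < maxn j.+1 N) g j l)).
    rewrite [leRHS](big_cat_nat (leq0n N) (leq_maxr _ _))/= lerDl.
    exact: sumr_ge0.
  rewrite addrAC lerDr addr_ge0//; apply: sumr_ge0 => i _; exact: sumr_ge0.
have /choice[d cd] : forall j, exists L : X, series (c j) @ \oo --> L.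
  by move=> j; exact: abs_summable_cvg (row j).
exists d; split => // [j|v L vs].
  by rewrite -ler_pdivlMr ?exprn_gt0//; exact: series_norm_le (row j) (cd j).
pose u j l := v ^+ j *: c j l.
have uK N : \sum_(0 <= j < N) \sum_(0 <= l < N) rnorm (u j l) <= K.
  apply: le_trans (gK N); apply: ler_sum => j _; apply: ler_sum => l _.
  by rewrite /u rnormZ rnormX ler_wpM2r ?rnorm_ge0//
    lerXn2r ?nnegrE ?rnorm_ge0 ?(ltW s0).
have uv j : series (u j) @ \oo --> v ^+ j *: d j.
  have -> : series (u j) = (fun n => v ^+ j *: series (c j) n).
    by apply/funext => n; rewrite /series/= scaler_sumr.
  exact: cvgZl_tmp (cd j).
have := diagonal_cvg u K _ uK uv L.
suff -> : power_series b (v + w) =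
  series (fun k => \sum_(0 <= j < k.+1) u j (k - j)%N) by [].
apply/funext => n; rewrite /power_series/series/=; apply: eq_bigr => k _.
rewrite (addrC v) exprDn scaler_suml big_mkord; apply: eq_bigr => -[j /=].
rewrite ltnS => jk _; rewrite /u /c subnKC// scalerA -mulr_natr.
by congr (_ *: _); ring.
Qed.

End complete.

(** * Bounded operators and real norms *)

Section bounded_operators.
Context {R : realType} {X : normedModType R[i]}.
Implicit Types (f : bounded_op X).

Lemma rnorm_op f x : rnorm (f x) <= rnorm f * rnorm x.
Proof. by rewrite -lecR rmorphM/= !rnormE; exact: ler_op_norm. Qed.

Lemma rnorm_op_le f (M : R) : 0 <= M ->
  (forall x, rnorm (f x) <= M * rnorm x) -> rnorm f <= M.
Proof.
move=> M0 fM; rewrite -lecR rnormE; apply: op_norm_le; first by rewrite ler0c.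
by move=> x; rewrite -!rnormE -rmorphM/= lecR.
Qed.

Lemma bounded_op_cvg f (u : nat -> X) (l : X) :
  u @ \oo --> l -> (fun n => f (u n)) @ \oo --> f l.
Proof.
move=> /cvg_rnormP ul; apply/cvg_rnormP => e e0.
have N0 : 0 < rnorm f + 1 by rewrite ltr_wpDl// rnorm_ge0.
have [N uN] := ul _ (divr_gt0 e0 N0); exists N => n /uN.
rewrite ltr_pdivlMr// -linearB; apply: le_lt_trans.
by rewrite (le_trans (rnorm_op _ _))// mulrC ler_wpM2l ?rnorm_ge0// lerDl.
Qed.

Lemma mk_bounded_op (f : X -> X) (K : R) : linear f ->
  (forall x, rnorm (f x) <= K * rnorm x) ->
  exists g : bounded_op X, forall x, g x = f x.
Proof.
move=> lf fK; have fb : f \in @bounded_linear R X.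
  apply/bounded_linearP; split=> //; exists K%:C => x.
  by rewrite -!rnormE -rmorphM/= lecR.
by exists (BoundedOp fb).
Qed.

End bounded_operators.

(** * A Baire category theorem *)

(** The closed sets cannot all have empty interior: otherwise there are nested
shrinking balls, one of them missing [A p] for each [p], and their common point
would belong to no [A p]. *)
Lemma baire {R : realType} {X : completeNormedModType R[i]} (A : nat -> set X) :
  (forall x, exists p, A p x) ->
  (forall p x, (forall e : R, 0 < e -> exists2 y, A p y & rnorm (y - x) < e) ->
    A p x) ->
  exists p (x : X) (e : R), 0 < e /\ forall y, rnorm (y - x) < e -> A p y.
Proof.
move=> Acover Aclosed; apply: contrapT => noball.
pose good (q : nat * (X * R)) (z : X * R) := 0 < q.2.2 ->
  [/\ 0 < z.2, z.2 <= q.2.2 / 2, rnorm (z.1 - q.2.1) <= q.2.2 / 2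
    & forall y, rnorm (y - z.1) <= z.2 -> ~ A q.1 y].
have /choice[f Hf] : forall q, exists z, good q z.
  move=> [p [x e]]; rewrite /good /=.
  have [e0|] := ltP 0 e; last by exists (x, e).
  have e2 : 0 < e / 2 by lra.
  have [y yx nAy] : exists2 y, rnorm (y - x) < e / 2 & ~ A p y.
    apply: contrapT => H; apply: noball; exists p, x, (e / 2); split=> // y yx.
    by apply: contrapT => nAy; apply: H; exists y.
  have [d d0 Hd] : exists2 d : R, 0 < d &
      forall z, rnorm (z - y) < d -> ~ A p z.
    apply: contrapT => H; apply: nAy; apply: Aclosed => d d0.
    apply: contrapT => H'; apply: H; exists d => // z zy Az; apply: H'.
    by exists z.
  exists (y, Num.min (e / 2) (d / 2)) => _ /=; split.
  - by rewrite lt_min e2/=; lra.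
  - by rewrite ge_min lexx.
  - exact: ltW.
  - move=> z; rewrite le_min => /andP[_ zy]; apply: Hd; lra.
pose fix q n : X * R := if n is m.+1 then f (m, q m) else (0, 1).
have q0 n : 0 < (q n).2 by elim: n => [|n ih] //=; have [] := Hf (n, q n) ih.
have qS n := Hf (n, q n) (q0 n).
(* The radii at least halve, so that the remaining displacement is at most the
   radius. *)
have dist n m : (n <= m)%N -> rnorm ((q m).1 - (q n).1) <= (q n).2 - (q m).2.
  move=> /subnKC <-; elim: (m - n)%N => [|k ih].
    by rewrite addn0 !subrr rnorm0.
  rewrite addnS; have [_ /= h1 h2 _] := qS (n + k)%N.
  have := rnormD ((f ((n + k)%N, q (n + k)%N)).1 - (q (n + k)%N).1)
    ((q (n + k)%N).1 - (q n).1).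
  rewrite addrA subrK /=; lra.
have [l ql] : exists l : X, series (fun k => (q k.+1).1 - (q k).1) @ \oo --> l.
  apply: (@abs_summable_cvg _ _ _ 1) => N.
  apply: (@le_trans _ _ (\sum_(0 <= k < N) (- (q k.+1).2 - - (q k).2))).
    by apply: ler_sum => k _; rewrite opprK [leRHS]addrC; apply: dist.
  by rewrite telescope_sumr//= opprK; have := q0 N; lra.
have {}ql : (fun n => (q n).1) @ \oo --> l.
  suff <- : series (fun k => (q k.+1).1 - (q k).1) = (fun n => (q n).1) by [].
  by apply/funext => n; rewrite /series/= telescope_sumr//= subr0.
have [p Apl] := Acover l.
have [_ _ _] := qS p; move=> /(_ l)/=; apply => //.
apply: (rnorm_cvg_le (cvgB ql (cvg_cst (q p.+1).1))).
exists p.+1 => n pn; rewrite !fctE; apply: le_trans (dist _ _ pn) _.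
by rewrite lerBlDr lerDl ltW.
Qed.

(** * Uniform expansion at one time *)

(** In [bounded_expansion] a common bound is imposed on all coefficients, which
passes to limits; [expandable] requires an expansion of every orbit, with bounds
proportional to the norm of the vector. *)
Definition bounded_expansion {R : realType} {X : normedModType R[i]}
    (S : R -> bounded_op X) (r M : R) (x : X) :=
  exists2 b : nat -> X, (forall k, rnorm (b k) * r ^+ k <= M) &
    forall s, `|s| <= r / 2 -> power_series b s%:C @ \oo --> S s x.

Definition expandable {R : realType} {X : normedModType R[i]}
    (S : R -> bounded_op X) (r K : R) :=
  forall x, exists2 b : nat -> X, wiener r (K * rnorm x) b &
    forall s, `|s| <= r -> power_series b s%:C @ \oo --> S s x.

Section linear_combinations.
Context {R : realType} {X : normedModType R[i]}.
Implicit Types (b c : nat -> X).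

Lemma power_seriesZ (a : R[i]) b w (L : X) : power_series b w @ \oo --> L ->
  power_series (fun k => a *: b k) w @ \oo --> a *: L.
Proof.
move=> bL; have -> : power_series (fun k => a *: b k) w =
    (fun n => a *: power_series b w n).
  apply/funext => n; rewrite /power_series/series/= scaler_sumr.
  by apply: eq_bigr => k _; rewrite !scalerA mulrC.
exact: cvgZl_tmp bL.
Qed.

Lemma power_seriesD b c w (L L' : X) :
  power_series b w @ \oo --> L -> power_series c w @ \oo --> L' ->
  power_series (fun k => b k + c k) w @ \oo --> L + L'.
Proof.
move=> bL cL; have -> : power_series (fun k => b k + c k) w =
    (fun n => power_series b w n + power_series c w n).
  apply/funext => n; rewrite /power_series/series/= -big_split/=.
  by apply: eq_bigr => k _; rewrite scalerDr.
exact: cvgD bL cL.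
Qed.

Lemma power_seriesN b w (L : X) : power_series b w @ \oo --> L ->
  power_series (fun k => - b k) w @ \oo --> - L.
Proof.
move=> /(power_seriesZ (-1)); rewrite scaleN1r.
suff -> : (fun k => -1 *: b k) = (fun k => - b k) by [].
by apply/funext => k; rewrite scaleN1r.
Qed.

Lemma power_series_op (f : bounded_op X) b w (L : X) :
  power_series b w @ \oo --> L ->
  power_series (fun k => f (b k)) w @ \oo --> f L.
Proof.
move=> /(bounded_op_cvg f).
suff -> : (fun n => f (power_series b w n)) =
  power_series (fun k => f (b k)) w by [].
apply/funext => n; rewrite /power_series/series/= linear_sum.
by apply: eq_bigr => k _; rewrite linearZ.
Qed.

Lemma wienerZ r K (a : R[i]) b :
  wiener r K b -> wiener r (rnorm a * K) (fun k => a *: b k).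
Proof.
move=> bK N.
apply: (@le_trans _ _ (rnorm a * \sum_(0 <= k < N) rnorm (b k) * r ^+ k)).
  by rewrite mulr_sumr; apply: ler_sum => k _; rewrite rnormZ mulrA.
by rewrite ler_wpM2l ?rnorm_ge0.
Qed.

End linear_combinations.

(** If [y j] tends to [x], then by [coef_small] the coefficients of [y j] of
each given index form a Cauchy sequence. Their limits are the coefficients of
[x], because the tail estimate is uniform in [j]. *)
Lemma bounded_expansion_closed {R : realType} {X : completeNormedModType R[i]}
    (S : R -> bounded_op X) (r M : R) (x : X) : 0 < r ->
  (forall e : R, 0 < e ->
    exists2 y, bounded_expansion S r M y & rnorm (y - x) < e) ->
  bounded_expansion S r M x.
Proof.
move=> r0 xcl.
have /choice[y Hy] : forall j : nat, exists y,
    bounded_expansion S r M y /\ rnorm (y - x) < j.+1%:R^-1.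
  by move=> j; have [//|y] := xcl j.+1%:R^-1; exists y.
have /choice[b Hb] : forall j, exists b : nat -> X,
    (forall k, rnorm (b k) * r ^+ k <= M) /\
    forall s, `|s| <= r / 2 -> power_series b s%:C @ \oo --> S s (y j).
  by move=> j; have [[b bM bS] _] := Hy j; exists b.
have yx : y @ \oo --> x.
  apply/cvg_rnormP => e e0; exists (Num.truncn e^-1) => n en.
  apply: lt_le_trans (Hy n).2 _; rewrite invf_ple ?posrE//.
  by rewrite (le_trans (ltW (truncnS_gt _)))// ler_nat ltnS.
have /choice[c bc] : forall k, exists c : X, (b^~ k) @ \oo --> c.
  move=> k; suff : cvg ((b^~ k) @ \oo) by move/cvg_ex.
  apply/cauchy_cvgP/cauchy_exP => e e0.
  have re : e \is Num.real by rewrite gtr0_real.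
  have Re0 : 0 < complex.Re e by rewrite -ltcR RRe_real.
  have [d d0 Hd] := coef_small S r (M + M) k r0 _ Re0.
  have d2 : 0 < d / 2 by lra.
  have [N yN] := (cvg_rnormP _ _).1 yx _ d2.
  exists (b N k); exists N => // n /= Nn.
  rewrite -ball_normE/= -rnormE rnormB -(RRe_real re) ltcR.
  apply: (Hd (y n - y N) (fun k => b n k - b N k)) => [i|s /andP[s0 sr]|].
  - rewrite (le_trans _ (lerD ((Hb n).1 i) ((Hb N).1 i)))// -mulrDl.
    rewrite ler_wpM2r ?exprn_ge0 ?(ltW r0)//.
    by rewrite (le_trans (rnormD _ _))// rnormN.
  - rewrite linearB; apply: power_seriesD; last apply: power_seriesN.
      by apply: (Hb n).2; rewrite gtr0_norm.
    by apply: (Hb N).2; rewrite gtr0_norm.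
  - have -> : y n - y N = (y n - x) - (y N - x) by rewrite opprB addrA subrK.
    have := rnormD (y n - x) (- (y N - x)); rewrite rnormN.
    have := yN n Nn; have := yN N (leqnn N); lra.
exists c => [k|s sr].
  rewrite -ler_pdivlMr ?exprn_gt0//; apply: (rnorm_cvg_le (bc k)).
  by exists 0%N => n _; rewrite ler_pdivlMr ?exprn_gt0//; apply: (Hb n).1.
have M0 : 0 <= M := coef_bound_ge0 _ _ _ r0 (Hb 0%N).1.
have tail n : rnorm (S s x - power_series c s%:C n) <=
    2 * M * (rnorm s%:C / r) ^+ n.
  have cn : (fun j => power_series (b j) s%:C n) @ \oo -->
      power_series c s%:C n.
    rewrite /power_series/series/=; elim: n => [|n ih].
      by rewrite big_geq//; under eq_fun do rewrite big_geq//; exact: cvg_cst.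
    rewrite big_nat_recr//=; under eq_fun do rewrite big_nat_recr//=.
    by apply: cvgD ih _; apply: cvgZl_tmp; exact: bc.
  apply: (rnorm_cvg_le (cvgB (bounded_op_cvg (S s) _ _ yx) cn)).
  exists 0%N => j _; rewrite !fctE; have [bM bS] := Hb j.
  by apply: power_series_tail => //; [rewrite rnormR|exact: bS].
apply/cvg_rnormP => e e0.
exists (Num.truncn (2 * M / e)) => n Nn; rewrite rnormB.
apply: le_lt_trans (tail n) _.
have q2 : rnorm s%:C / r <= 2^-1 by rewrite rnormR ler_pdivrMr// mulrC.
apply: (@le_lt_trans _ _ (2 * M * 2^-1 ^+ n)).
  rewrite ler_wpM2l ?mulr_ge0// lerXn2r ?nnegrE//.
  by rewrite divr_ge0 ?rnorm_ge0 ?(ltW r0).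
rewrite exprVn ltr_pdivrMr ?exprn_gt0// [ltRHS]mulrC -ltr_pdivrMr//.
apply: lt_le_trans (truncnS_gt _) _.
by rewrite -natrX ler_nat; apply: leq_ltn_trans Nn (ltn_expl _ _).
Qed.

(** A small multiple of any vector is the difference of two elements of the
ball, and the coefficients may be subtracted and scaled. *)
Lemma bounded_expansion_ball {R : realType} {X : normedModType R[i]}
    (S : R -> bounded_op X) (r M e : R) (x0 : X) : 0 < r -> 0 < e ->
  (forall y, rnorm (y - x0) < e -> bounded_expansion S r M y) ->
  exists2 K : R, 0 <= K & expandable S (r / 2) K.
Proof.
move=> r0 e0 ball_exp.
have [b0 b0M b0S] : bounded_expansion S r M x0.
  by apply: ball_exp; rewrite subrr rnorm0.
have M0 : 0 <= M := coef_bound_ge0 _ _ _ r0 b0M.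
exists (2 / e * (2 * (M + M))).
  by rewrite !mulr_ge0 ?invr_ge0 ?addr_ge0// ltW.
move=> x; have [->|xn0] := eqVneq x 0.
  exists (fun=> 0) => [N|s _].
    by rewrite big1 ?rnorm0 ?mulr0// => k _; rewrite mul0r.
  rewrite linear0; have -> : power_series (fun=> 0) s%:C = fun=> (0 : X).
    by apply/funext => n; rewrite /power_series/series/= big1// => k _;
      rewrite scaler0.
  exact: cvg_cst.
have xg0 := rnorm_gt0 x xn0.
pose a := 2 / e * rnorm x; have a0 : 0 < a by rewrite mulr_gt0// divr_gt0.
have an0 : a%:C != 0 :> R[i].
  by rewrite -(rmorph0 (real_complex R)) (inj_eq (@complexI _)) gt_eqF.
(* [y] is the multiple of [x] of norm [e / 2]. *)
pose y := a%:C^-1 *: x.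
have yE : rnorm y = e / 2.
  rewrite /y -fmorphV/= rnormZ rnormR gtr0_norm ?invr_gt0// /a.
  by field; rewrite (gt_eqF xg0) (gt_eqF e0).
have [b1 b1M b1S] : bounded_expansion S r M (y + x0).
  by apply: ball_exp; rewrite addrK yE; lra.
have cM k : rnorm (b1 k - b0 k) * r ^+ k <= M + M.
  rewrite (le_trans _ (lerD (b1M k) (b0M k)))//
    -mulrDl ler_wpM2r ?exprn_ge0 ?(ltW r0)//.
  by rewrite (le_trans (rnormD _ _))// rnormN.
exists (fun k => a%:C *: (b1 k - b0 k)) => [|s sr].
  have := wienerZ _ _ a%:C _ (coef_wiener _ _ _ r0 cM).
  by rewrite rnormR gtr0_norm// /a; congr (wiener _ _ _); ring.
have -> : S s x = a%:C *: (S s (y + x0) - S s x0).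
  by rewrite -linearB addrK -linearZ /y scalerA mulfV// scale1r.
apply: power_seriesZ; apply: power_seriesD; first exact: b1S.
by apply: power_seriesN; exact: b0S.
Qed.

(** The terms of a convergent power series are bounded, so that [m] may be
chosen to dominate both this bound and the inverse of the radius. *)
Lemma analytic_bounded_expansion {R : realType} {X : normedModType R[i]}
    (T : R -> bounded_op X) (x : X) :
  individually_eventually_real_analytic T ->
  exists n m : nat,
    bounded_expansion (fun s => T (n.+1%:R + s)) m.+1%:R^-1 m.+1%:R x.
Proof.
move=> /(_ x)[tx tx0 an]; pose n := Num.truncn tx; exists n.
have [r r0 [b bS]] : exists2 r : R, 0 < r & exists b : X^nat,
    forall s, s \in `](n.+1%:R - r), (n.+1%:R + r)[ ->
      series (fun k => ((s - n.+1%:R) ^+ k)%:C *: b k) @ \oo --> T s x.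
  by apply: an; rewrite /= in_itv/= truncnS_gt.
have {}bS s : `|s| < r -> power_series b s%:C @ \oo --> T (n.+1%:R + s) x.
  move=> sr; have := bS (n.+1%:R + s).
  rewrite in_itv/= !ltrD2l -ltr_norml sr => /(_ isT).
  rewrite addrAC subrr add0r /power_series.
  by under eq_fun do rewrite rmorphXn.
have rh : `|r / 2| < r by rewrite gtr0_norm; lra.
have [N bN] := (cvg_rnormP _ _).1 (bS _ rh) 1 ltr01.
pose t k := rnorm ((r / 2)%:C ^+ k *: b k).
have tE k : t k = rnorm (b k) * (r / 2) ^+ k.
  by rewrite /t rnormZ rnormX rnormR gtr0_norm 1?mulrC//; lra.
pose M := \sum_(0 <= k < N) t k + 2.
have t0 k : 0 <= t k by exact: rnorm_ge0.
have tM k : t k <= M.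
  have [kN|Nk] := ltnP k N.
    rewrite /M (big_cat_nat (leq0n k.+1) kN)/= big_nat_recr//=.
    have := @sumr_ge0 _ _ (index_iota 0 k) xpredT t (fun i _ => t0 i).
    have := @sumr_ge0 _ _ (index_iota k.+1 N) xpredT t (fun i _ => t0 i).
    lra.
  have h1 := bN k Nk; have h2 := bN k.+1 (leqW Nk).
  set L := T _ x in h1 h2; set P := power_series b _ in h1 h2.
  have -> : t k = rnorm ((P k.+1 - L) - (P k - L)).
    by rewrite opprB addrA subrK /P /power_series seriesSB.
  have := rnormD (P k.+1 - L) (- (P k - L)); rewrite rnormN.
  have : 0 <= \sum_(0 <= k < N) t k by exact: sumr_ge0.
  rewrite /M; lra.
pose m := Num.truncn (Num.max M (2 / r)); exists m.
have := truncnS_gt (Num.max M (2 / r)); rewrite -/m gt_max => /andP[Mm rm].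
have mr : m.+1%:R^-1 <= r / 2.
  by rewrite -[leRHS]invrK lef_pV2 ?posrE ?invr_gt0 ?divr_gt0// invf_div ltW.
exists b => [k|s sm].
  apply: le_trans (ltW Mm); apply: le_trans (tM k); rewrite tE.
  rewrite ler_wpM2l ?rnorm_ge0// lerXn2r ?nnegrE//; lra.
by apply: bS; move: sm mr; set q := _^-1; lra.
Qed.

(** Baire, for the pairs [(n, m)] of [analytic_bounded_expansion] enumerated by
[pickle]. The bound [r <= a] keeps the times [a + s] nonnegative, as the
semigroup law requires. *)
Lemma uniform_expansion {R : realType} {X : completeNormedModType R[i]}
    (T : R -> bounded_op X) :
  individually_eventually_real_analytic T ->
  exists a r K : R, [/\ 0 < r, r <= a, 0 <= K
    & expandable (fun s => T (a + s)) r K].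
Proof.
move=> Tan.
pose A p := let: (n, m) := odflt (0, 0)%N (unpickle p) in
  bounded_expansion (fun s => T (n.+1%:R + s)) m.+1%:R^-1 m.+1%:R.
have Acover x : exists p, A p x.
  have [n [m Hx]] := analytic_bounded_expansion T x Tan.
  by exists (pickle (n, m)); rewrite /A pickleK.
have Aclosed p x :
    (forall e : R, 0 < e -> exists2 y, A p y & rnorm (y - x) < e) -> A p x.
  by rewrite /A; case: (odflt _ _) => n m; apply: bounded_expansion_closed;
    rewrite invr_gt0.
have [p [x [e [e0 +]]]] := baire A Acover Aclosed.
rewrite /A; case: (odflt _ _) => n m Hp.
have m0 : 0 < m.+1%:R^-1 :> R by rewrite invr_gt0.
have [K K0 HK] := bounded_expansion_ball _ _ _ _ _ m0 e0 Hp.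
exists n.+1%:R, (m.+1%:R^-1 / 2), K; split => //.
have h1 : m.+1%:R^-1 <= 1 :> R by rewrite invf_le1// ler1n.
have h2 : 1 <= n.+1%:R :> R by rewrite ler1n.
by move: h1 h2 m0; set q := m.+1%:R^-1; lra.
Qed.

(** * Expansions at all later times *)

Section expandable.
Context {R : realType} {X : normedModType R[i]}.
Implicit Types (S : R -> bounded_op X) (r K : R).

(** Coefficients are unique, hence linear in the vector; the Wiener bound makes
them bounded operators. *)
Lemma expandable_coef S r K : 0 < r -> expandable S r K ->
  exists B : nat -> bounded_op X, forall x,
    wiener r (K * rnorm x) (fun k => B k x) /\
    forall s, `|s| <= r -> power_series (fun k => B k x) s%:C @ \oo --> S s x.
Proof.
move=> r0 SK; have /choice[b Hb] : forall x, exists b : nat -> X,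
    wiener r (K * rnorm x) b /\
    forall s, `|s| <= r -> power_series b s%:C @ \oo --> S s x.
  by move=> x; have [b] := SK x; exists b.
have bK x k : rnorm (b x k) * r ^+ k <= K * rnorm x.
  by apply: wiener_coef (Hb x).1; exact: ltW.
have /choice[B HB] : forall k, exists f : bounded_op X, forall x, f x = b x k.
  move=> k; apply: (@mk_bounded_op _ _ _ (K / r ^+ k)) => [a x y|x]; last first.
    by rewrite mulrAC ler_pdivlMr ?exprn_gt0.
  pose M := Num.max (K * rnorm (a *: x + y))
    (rnorm a * (K * rnorm x) + K * rnorm y).
  apply: (@power_series_unique _ _ r M _ (fun k => a *: b x k + b y k)
    (fun s => S s (a *: x + y))) => // [i|i|s|s].
  - by rewrite /M le_max bK.
  - rewrite /M le_max; apply/orP; right.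
    rewrite (le_trans (ler_wpM2r _ (rnormD _ _))) ?exprn_ge0 ?(ltW r0)// mulrDl.
    by rewrite rnormZ -mulrA lerD// ler_wpM2l ?rnorm_ge0.
  - by move=> /andP[s0 sr]; apply: (Hb _).2; rewrite gtr0_norm//; lra.
  - move=> /andP[s0 sr]; rewrite linearP; apply: power_seriesD.
      by apply: power_seriesZ; apply: (Hb _).2; rewrite gtr0_norm//; lra.
    by apply: (Hb _).2; rewrite gtr0_norm//; lra.
exists B => x; have -> : (fun k => B k x) = b x.
  by apply/funext => k; rewrite HB.
exact: Hb.
Qed.

Lemma expandable_ext S S' r K : (forall s, `|s| <= r -> S s = S' s) ->
  expandable S r K -> expandable S' r K.
Proof.
by move=> SS' SK x; have [b bK bS] := SK x; exists b => // s sr;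
  rewrite -SS'//; exact: bS.
Qed.

(** The coefficients of the composite are the Cauchy products of the
coefficients of the factors. *)
Lemma expandable_comp S S' r K K' : 0 < r -> 0 <= K ->
  expandable S r K -> expandable S' r K' ->
  expandable (fun s => bounded_op_comp (S s) (S' s)) r (K * K').
Proof.
move=> r0 K0 /(expandable_coef _ _ _ r0)[B HB] SK' x.
have [c cK cS'] := SK' x.
pose u s j l : X := (s%:C ^+ j) *: B j (s%:C ^+ l *: c l).
have uK s N : `|s| <= r ->
    \sum_(0 <= j < N) \sum_(0 <= l < N) rnorm (u s j l) <= K * K' * rnorm x.
  move=> sr; rewrite exchange_big/=.
  apply: (@le_trans _ _ (\sum_(0 <= l < N) K * (rnorm (c l) * r ^+ l))).
    apply: ler_sum => l _; rewrite mulrA.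
    apply: le_trans (ler_wpM2r _ ((HB (c l)).1 N));
      last by rewrite exprn_ge0 ?(ltW r0).
    rewrite mulr_suml; apply: ler_sum => j _.
    rewrite /u linearZ/= !rnormZ !rnormX rnormR mulrA mulrC -[leRHS]mulrA.
    rewrite ler_wpM2l ?rnorm_ge0// -!exprD lerXn2r ?nnegrE//; exact: ltW.
  rewrite -mulr_sumr -mulrA ler_wpM2l//; exact: cK.
exists (fun k => \sum_(0 <= j < k.+1) B j (c (k - j)%N)) => [N|s sr].
  apply: le_trans (uK r N _); last by rewrite gtr0_norm.
  apply: (@le_trans _ _
    (\sum_(0 <= k < N) \sum_(0 <= j < k.+1) rnorm (u r j (k - j)%N))).
    apply: ler_sum => k _.
    rewrite (le_trans (ler_wpM2r _ (rnorm_sum _ _ _ _))) ?exprn_ge0 ?(ltW r0)//.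
    rewrite mulr_suml !big_nat; apply: ler_sum => j;
      rewrite ltnS => /andP[_ jk].
    rewrite /u linearZ/= !rnormZ !rnormX rnormR gtr0_norm//
      mulrA -exprD subnKC//.
    by rewrite mulrC.
  rewrite (triangle_sum (fun j l => rnorm (u r j l))) !big_nat.
  apply: ler_sum => j /andP[_ jN].
  rewrite [leRHS](big_cat_nat (leq0n (N - j)) (leq_subr _ _))/= lerDl.
  by apply: sumr_ge0 => l _; exact: rnorm_ge0.
pose v j := s%:C ^+ j *: B j (S' s x).
have uv j : series (u s j) @ \oo --> v j.
  have -> : series (u s j) = fun n => s%:C ^+ j *: B j (power_series c s%:C n).
    by apply/funext => n; rewrite /power_series /series/= linear_sum
      scaler_sumr.
  by apply: cvgZl_tmp; apply: bounded_op_cvg; exact: cS'.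
have := (HB (S' s x)).2 s sr.
move=> /(diagonal_cvg (u s) _ v (fun N => uK s N sr) uv _).1.
suff -> : power_series (fun k => \sum_(0 <= j < k.+1) B j (c (k - j)%N)) s%:C =
  series (fun k => \sum_(0 <= j < k.+1) u s j (k - j)%N) by [].
apply/funext => n; rewrite /power_series/series/=; apply: eq_bigr => k _.
rewrite scaler_sumr !big_nat; apply: eq_bigr => j; rewrite ltnS => /andP[_ jk].
by rewrite /u linearZ scalerA -exprD subnKC.
Qed.

End expandable.

Section semigroup.
Context {R : realType} {X : completeNormedModType R[i]}.
Variables (T : R -> bounded_op X) (a r K : R).
Hypotheses (T_semigroup : semigroup_property T).
Hypotheses (r0 : 0 < r) (ra : r <= a) (K0 : 0 <= K).
Hypothesis Ta : expandable (fun s => T (a + s)) r K.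

Lemma expandable_multiple k :
  exists2 K' : R, 0 <= K' & expandable (fun s => T (k.+1%:R * (a + s))) r K'.
Proof.
elim: k => [|k [K' K'0 ih]].
  by exists K => //; apply: expandable_ext Ta => s _; rewrite mul1r.
exists (K * K'); first exact: mulr_ge0.
apply: expandable_ext (expandable_comp _ _ _ _ _ r0 K0 Ta ih) => s.
rewrite ler_norml => /andP[sr _].
have as0 : 0 <= a + s by rewrite (le_trans _ (lerD ra sr))// subrr.
by rewrite -T_semigroup ?mulr_ge0// -{1}[a + s]mul1r -mulrDl nat1r.
Qed.

(** With [k] the integer part of [t / a], the time [t + s] is the sum of
[t - k * a >= 0] and of [k * (a + s / k)]. As a function of [s / k] the second
operator expands with radius [r], hence with radius [k * r] as a function of
[s]; and [(t - a) / a < k]. *)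
Lemma expandable_at t : a < t ->
  exists2 K' : R, 0 <= K' &
    expandable (fun s => T (t + s)) ((t - a) / a * r) K'.
Proof.
move=> at_; have a0 : 0 < a by exact: lt_le_trans ra.
pose k := Num.truncn (t / a).
have k0 : (0 < k)%N by rewrite truncn_gt0 ler_pdivlMr// mul1r ltW.
have /andP[ka_t t_ka] : k%:R <= t / a < k.+1%:R.
  by rewrite truncn_itv// divr_ge0 ?ltW// (lt_trans a0).
have kr0 : 0 < k%:R :> R by rewrite ltr0n.
have kC0 : k%:R != 0 :> R[i] by rewrite pnatr_eq0 -lt0n.
have tau0 : 0 <= t - k%:R * a by rewrite subr_ge0 -ler_pdivlMr.
have [K' K'0] := expandable_multiple k.-1; rewrite prednK// => HK'.
exists (rnorm (T (t - k%:R * a)) * K'); first by rewrite mulr_ge0 ?rnorm_ge0.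
move=> x; have [c cK cT] := HK' x.
have rho_k : (t - a) / a * r <= k%:R * r.
  rewrite ler_wpM2r ?(ltW r0)// mulrBl divff ?gt_eqF// ltW// ltrBlDr.
  by rewrite -natr1 in t_ka.
have rho0 : 0 < (t - a) / a * r by rewrite mulr_gt0// divr_gt0// subr_gt0.
have kV : rnorm (k%:R^-1 : R[i]) = k%:R^-1.
  by rewrite -(rmorph_nat (real_complex R)) -fmorphV/= rnormR ger0_norm
    ?invr_ge0.
exists (fun j => T (t - k%:R * a) ((k%:R^-1 ^+ j) *: c j)) => [N|s sr].
  apply: (@le_trans _ _
    (\sum_(0 <= j < N) rnorm (T (t - k%:R * a)) * (rnorm (c j) * r ^+ j))).
    apply: ler_sum => j _.
    rewrite (le_trans (ler_wpM2r _ (rnorm_op _ _))) ?exprn_ge0 ?(ltW rho0)//.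
    rewrite -[leLHS]mulrA ler_wpM2l ?rnorm_ge0// rnormZ rnormX kV mulrAC mulrC.
    rewrite ler_wpM2l ?rnorm_ge0// -exprMn lerXn2r// ?nnegrE ?(ltW r0)//.
      by rewrite mulr_ge0 ?invr_ge0// ltW.
    by rewrite ler_pdivrMl.
  by rewrite -mulr_sumr -mulrA ler_wpM2l ?rnorm_ge0.
have sk : `|s / k%:R| <= r.
  by rewrite normrM normfV (gtr0_norm kr0) ler_pdivrMr// mulrC (le_trans sr).
have -> : T (t + s) x = T (t - k%:R * a) (T (k%:R * (a + s / k%:R)) x).
  have -> : t + s = (t - k%:R * a) + k%:R * (a + s / k%:R).
    by rewrite mulrDr addrA subrK mulrC divfK ?gt_eqF.
  rewrite T_semigroup// mulr_ge0//; move: sk; rewrite ler_norml => /andP[sk _].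
  by rewrite (le_trans _ (lerD ra sk))// subrr.
apply: power_series_op.
suff <- : power_series c (s / k%:R)%:C =
    power_series (fun j => k%:R^-1 ^+ j *: c j) s%:C.
  exact: cT.
apply/funext => n; rewrite /power_series/series/=; apply: eq_bigr => j _.
by rewrite scalerA -exprMn rmorphM/= fmorphV/= rmorph_nat.
Qed.

End semigroup.

(** * Holomorphic extension *)

(** With [phi] the argument of [z - a], the inequalities
[sin (atan c - phi) > 0] and [sin (atan c + phi) > 0] read
[|sin phi| < c cos phi]. *)
Lemma sector_slope {R : realType} (a c : R) (z : R[i]) :
  sector a (atan c) z -> `|complex.Im z| < c * (complex.Re z - a).
Proof.
move=> [az]; set u := z - a%:C; set phi := carg u;
  rewrite ltr_norml => /andP[phi1 phi2].
have u0 : u != 0.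
  apply/eqP => /(congr1 (@complex.Re R)); rewrite /u;
    case: (z) az => x y /= ax; lra.
have [_ _] := cargP u0; rewrite -/phi -rnormE => uE.
have n0 := rnorm_gt0 u u0.
have Reu : complex.Re z - a = rnorm u * cos phi.
  have := congr1 (@complex.Re R) uE; rewrite /u; case: (z) => x y /=; lra.
have Imu : complex.Im z = rnorm u * sin phi.
  have := congr1 (@complex.Im R) uE; rewrite /u; case: (z) => x y /=; lra.
rewrite Reu Imu normrM gtr0_norm// mulrCA ltr_pM2l//.
have th1 := atan_gtNpi2 c; have th2 := atan_ltpi2 c.
have cth : 0 < cos (atan c) by apply: cos_gt0_pihalf; rewrite th1.
have sth : sin (atan c) = c * cos (atan c).
  by rewrite -{2}(atanK c) /tan divfK ?gt_eqF.
have p0 := pi_gt0 R.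
rewrite ltr_norml; apply/andP; split.
  have : 0 < sin (atan c - - phi) by apply: sin_gt0_pi; apply/andP; split; lra.
  rewrite sinB sinN cosN mulrN opprK sth -(pmulr_rgt0 _ cth); nra.
have : 0 < sin (atan c - phi) by apply: sin_gt0_pi; apply/andP; split; lra.
rewrite sinB sth; nra.
Qed.

Lemma Re_le_rnorm {R : realType} (z : R[i]) : `|complex.Re z| <= rnorm z.
Proof. by rewrite -lecR rnormE normc_ge_Re. Qed.

Lemma rnorm_im {R : realType} (y : R) : rnorm (0 +i* y) = `|y|.
Proof. by rewrite /rnorm normc_def/= expr0n/= add0r sqrtr_sqr. Qed.

Lemma Im_le_rnorm {R : realType} (z : R[i]) : `|complex.Im z| <= rnorm z.
Proof.
have <- : complex.Re (- 'i%C * z) = complex.Im z.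
  by case: z => x y /=; rewrite oppr0 mul0r mulN1r opprK add0r.
rewrite (le_trans (Re_le_rnorm _))// rnormM rnormN rnorm_im normr1 mul1r//.
Qed.

(** Two expansions of the same function of a real variable, at [0] and at [s],
agree on complex arguments too: the recentered first series and the second one
have the same sums on a real interval, hence the same coefficients. *)
Lemma recenter_real {R : realType} {X : completeNormedModType R[i]} (f : R -> X)
    (b c : nat -> X) (r r' K K' s : R) :
  wiener r K b -> wiener r' K' c -> `|s| < r -> 0 < r' ->
  (forall v, `|v| <= r -> power_series b v%:C @ \oo --> f v) ->
  (forall v, `|v| <= r' -> power_series c v%:C @ \oo --> f (s + v)) ->
  forall w (L : X), rnorm w <= r - `|s| ->
    power_series c w @ \oo --> L <-> power_series b (w + s%:C) @ \oo --> L.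
Proof.
move=> bK cK sr r'0 bf cf w L wr.
have sr' : rnorm s%:C < r by rewrite rnormR.
have [d [_ dK dL]] := recenter _ _ _ _ bK sr'.
rewrite rnormR in dK dL.
suff -> : c = d by exact: dL.
(* A radius for which both coefficient sequences are bounded. *)
pose r0 := Num.min (r - `|s|) r'.
have r00 : 0 < r0 by rewrite lt_min subr_gt0 sr.
have r0s : r0 <= r - `|s| by rewrite ge_min lexx.
have r0r' : r0 <= r' by rewrite ge_min lexx orbT.
have shrink (x : X) i rho : r0 <= rho ->
    rnorm x * r0 ^+ i <= rnorm x * rho ^+ i.
  move=> h; rewrite ler_wpM2l ?rnorm_ge0// lerXn2r ?nnegrE ?(ltW r00)//.
  by apply: le_trans h; exact: ltW.
apply/funext; apply: (@power_series_unique _ _ r0 (Num.max K K') _ _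
  (fun v => f (s + v))) => //.
- move=> i; rewrite le_max; apply/orP; right.
  by rewrite (le_trans (shrink _ _ _ r0r'))// wiener_coef// ltW.
- by move=> i; rewrite le_max (le_trans (shrink _ _ _ r0s) (dK i)).
- move=> v /andP[v0 vr]; apply: cf; rewrite gtr0_norm//; lra.
- move=> v /andP[v0 vr]; apply/dL; first by rewrite rnormR gtr0_norm//; lra.
  rewrite -rmorphD/= addrC; apply: bf.
  have := ler_normD s v; rewrite (gtr0_norm v0); lra.
Qed.

Lemma operator_sum {R : realType} {X : completeNormedModType R[i]}
    (B : nat -> bounded_op X) (r K : R) (w : R[i]) :
  (forall x, wiener r (K * rnorm x) (fun k => B k x)) -> rnorm w <= r ->
  exists G : bounded_op X, forall x,
    power_series (fun k => B k x) w @ \oo --> G x.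
Proof.
move=> BK wr.
have /choice[g Hg] : forall x, exists L : X,
    power_series (fun k => B k x) w @ \oo --> L /\ rnorm L <= K * rnorm x.
  by move=> x; have [L] := wiener_cvg _ _ _ _ (BK x) wr; exists L.
have [x y z|x|G HG] := @mk_bounded_op _ _ g K.
- apply: cvg_unique (Hg _).1 _ => //.
  have -> : (fun k => B k (x *: y + z)) = (fun k => x *: B k y + B k z).
    by apply/funext => k; rewrite linearP.
  by apply: power_seriesD; [apply: power_seriesZ|]; exact: (Hg _).1.
- exact: (Hg x).2.
by exists G => x; rewrite HG; exact: (Hg x).1.
Qed.

(** Recentering at [w0] gives
[F (z0 + h) x = d_0 x + h d_1 x + O(|h|^2 |x|)], with a constant which does not
depend on [x]. So the difference quotients converge to [d_1] in the operator
norm. *)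
Lemma derivable_power_series {R : realType} {X : completeNormedModType R[i]}
    (B : nat -> bounded_op X) (r K delta : R) (w0 z0 : R[i])
    (F : R[i] -> bounded_op X) :
  0 <= K -> (forall x, wiener r (K * rnorm x) (fun k => B k x)) ->
  rnorm w0 < r -> 0 < delta ->
  (forall (h : R[i]) x, rnorm h < delta ->
    power_series (fun k => B k x) (h + w0) @ \oo --> F (h + z0) x) ->
  derivable F z0 1.
Proof.
move=> K0 BK w0r delta0 BF; set s := r - rnorm w0.
have s0 : 0 < s by rewrite subr_gt0.
have /choice[d Hd] : forall x, exists d : nat -> X,
  [/\ forall j, series (fun l => ('C(j + l, j)%:R * w0 ^+ l) *: B (j + l)%N x)
        @ \oo --> d j,
      forall j, rnorm (d j) * s ^+ j <= K * rnorm x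
    & forall (v : R[i]) (L : X), rnorm v <= s ->
      power_series d v @ \oo --> L <->
      power_series (fun k => B k x) (v + w0) @ \oo --> L].
  by move=> x; exact: recenter _ _ _ _ (BK x) w0r.
have [x y z|x|D HD] := @mk_bounded_op _ _ (fun x => d x 1%N) (K / s).
- have [dl _ _] := Hd (x *: y + z); apply: cvg_unique (dl 1%N) _ => //.
  have [yl _ _] := Hd y; have [zl _ _] := Hd z.
  pose c l : R[i] := 'C(1 + l, 1)%:R * w0 ^+ l.
  have -> : series (fun l => c l *: B (1 + l)%N (x *: y + z)) =
      fun n => x *: series (fun l => c l *: B (1 + l)%N y) n
               + series (fun l => c l *: B (1 + l)%N z) n.
    apply/funext => n; rewrite /series/= scaler_sumr -big_split/=.
    by apply: eq_bigr => l _; rewrite linearP scalerDr !scalerA (mulrC x).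
  by apply: cvgD (zl 1%N); apply: cvgZl_tmp (yl 1%N).
- by have [_ /(_ 1%N) + _] := Hd x; rewrite mulrAC ler_pdivlMr.
have taylor (h : R[i]) x : rnorm h < delta -> rnorm h <= s / 2 ->
    rnorm (F (h + z0) x - (d x 0%N + h *: d x 1%N)) <=
    2 * (K * rnorm x) * (rnorm h / s) ^+ 2.
  move=> hd hs; have [_ dK dB] := Hd x.
  have := @power_series_tail _ _ (d x) s _ h (F (h + z0) x) 2 s0 dK hs.
  rewrite /power_series/series/= big_nat_recr//= big_nat1 expr0 scale1r expr1.
  by apply; apply/dB; [lra|exact: BF].
have F0 x : F z0 x = d x 0%N.
  apply/eqP; rewrite -subr_eq0; apply/eqP/rnorm_eq0 => e e0.
  have := taylor 0 x; rewrite rnorm0 add0r scale0r addr0 mul0r expr0n/= mulr0.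
  by move=> /(_ delta0) H; rewrite (le_trans (H _))//; lra.
have quot (h : R[i]) : h != 0 -> rnorm h < delta -> rnorm h <= s / 2 ->
    rnorm (D - h^-1 *: (F (h + z0) - F z0)) <= 2 * K / s ^+ 2 * rnorm h.
  move=> hn0 hd hs; have h0 := rnorm_gt0 h hn0.
  apply: rnorm_op_le => [|x].
    by rewrite !mulr_ge0 ?invr_ge0 ?exprn_ge0 ?rnorm_ge0// ltW.
  rewrite -(ler_pM2l h0) -rnormZ.
  have -> : h *: (D - h^-1 *: (F (h + z0) - F z0)) x =
      - (F (h + z0) x - (d x 0%N + h *: d x 1%N)).
    have -> : (D - h^-1 *: (F (h + z0) - F z0)) x =
      D x - h^-1 *: (F (h + z0) x - F z0 x) by [].
    rewrite scalerBr scalerA mulfV// scale1r HD F0.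
    by rewrite !opprB addrA (addrC (h *: _)).
  rewrite rnormN (le_trans (taylor h x hd hs))// le_eqVlt; apply/orP; left;
    apply/eqP.
  by field; rewrite gt_eqF.
rewrite /derivable; apply/cvg_ex; exists D; apply/cvgrPdist_lt => e e0.
have re : e \is Num.real by rewrite gtr0_real.
have Re0 : 0 < complex.Re e by rewrite -ltcR RRe_real.
pose C := 2 * K / s ^+ 2 + 1.
have C0 : 0 < C by rewrite ltr_wpDl// !mulr_ge0 ?invr_ge0 ?exprn_ge0// ltW.
pose eta := Num.min delta (Num.min (s / 2) (complex.Re e / C)).
have eta0 : 0 < eta by rewrite !lt_min delta0 !divr_gt0.
apply/nbhs_ballP; exists eta%:C; first by rewrite /= ltcR.
move=> h; rewrite -ball_normE/= sub0r normrN -rnormE ltcR => heta hn0.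
move: heta; rewrite !lt_min => /and3P[hd hs he].
rewrite -rnormE -(RRe_real re) ltcR -[h *: 1]/(h * 1) mulr1.
apply: le_lt_trans (quot h hn0 hd (ltW hs)) _.
move: he; rewrite ltr_pdivlMr// mulrC; apply: le_lt_trans.
by rewrite ler_wpM2r ?rnorm_ge0// /C lerDl.
Qed.

Theorem corollary3p30 (R : realType) (X : completeNormedModType R[i])
    (T : R -> bounded_op X)
    (T_analytic : individually_eventually_real_analytic T)
    (T_semigroup : semigroup_property T) :
  exists t theta : R, 0 <= t /\ 0 < theta <= pi / 2 /\
    exists F : R[i] -> bounded_op X,
      holomorphic_on (sector t theta) F /\
      forall s : R, t < s -> F s%:C = T s.
Proof.
have [a [r [K [r0 ra K0 Ta]]]] := uniform_expansion T T_analytic.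
have a0 : 0 < a := lt_le_trans r0 ra.
pose rho t := (t - a) / a * r.
have rho0 t : a < t -> 0 < rho t.
  by move=> ta; rewrite mulr_gt0// divr_gt0// subr_gt0.
have /choice[BK HBK] : forall t, exists BK : (nat -> bounded_op X) * R, a < t ->
    0 <= BK.2 /\ forall x,
      wiener (rho t) (BK.2 * rnorm x) (fun k => BK.1 k x) /\
      forall s, `|s| <= rho t ->
        power_series (fun k => BK.1 k x) s%:C @ \oo --> T (t + s) x.
  move=> t; have [ta|] := ltP a t; last by exists (fun=> 0, 0).
  have [K' K'0 Tt] := expandable_at T a r K T_semigroup r0 ra K0 Ta t ta.
  have [B HB] := expandable_coef _ _ _ (rho0 t ta) Tt.
  by exists (B, K').
pose b t x k := (BK t).1 k x.
have /choice[F HF] : forall z : R[i], exists G : bounded_op X,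
    a < complex.Re z -> `|complex.Im z| <= rho (complex.Re z) -> forall x,
    power_series (b (complex.Re z) x) (0 +i* complex.Im z) @ \oo --> G x.
  move=> z; have [az|] := ltP a (complex.Re z); last by exists 0.
  have [zr|] := leP `|complex.Im z| (rho (complex.Re z)); last by exists 0.
  have [G HG] := operator_sum (BK (complex.Re z)).1 (rho (complex.Re z))
    (BK (complex.Re z)).2 (0 +i* complex.Im z)
    (fun x => ((HBK _ az).2 x).1) (eq_ind_r (fun u => u <= _) zr (rnorm_im _)).
  by exists G.
exists a, (atan (r / a)); split; first exact: ltW.
split; first by rewrite -{1}(@atan0 R) lt_atan ?divr_gt0//= ltW// atan_ltpi2.
exists F; split; last first.
  move=> s as_; apply: bounded_opP => x.
  have := HF s%:C as_; rewrite /= normr0 => /(_ (ltW (rho0 s as_)) x) Fs.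
  have := ((HBK s as_).2 x).2 0; rewrite normr0 addr0 =>
    /(_ (ltW (rho0 s as_))).
  exact: cvg_unique Fs.
move=> z zS; have az : a < complex.Re z by case: zS.
have zrho : `|complex.Im z| < rho (complex.Re z).
  by apply: lt_le_trans (sector_slope _ _ _ zS) _;
    rewrite /rho mulrC mulrA mulrAC.
set t := complex.Re z in az zrho *; set y := complex.Im z in zrho *.
(* The first bound keeps both [y + h2] within the radius left at [t + h1] and
   [|h1| + |y + h2|] below [rho t]. *)
pose delta := Num.min ((rho t - `|y|) / 2) (t - a).
have delta0 : 0 < delta by rewrite lt_min subr_gt0 az andbT divr_gt0// subr_gt0.
apply: (@derivable_power_series _ _ (BK t).1 (rho t) (BK t).2 delta (0 +i* y)).
- exact: (HBK t az).1.
- by move=> x; exact: ((HBK t az).2 x).1.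
- by rewrite rnorm_im.
- exact: delta0.
move=> h x hd; pose h1 := complex.Re h; pose h2 := complex.Im h.
have h1d : `|h1| < delta by exact: le_lt_trans (Re_le_rnorm h) hd.
have h2d : `|h2| < delta by exact: le_lt_trans (Im_le_rnorm h) hd.
have d1 : delta <= (rho t - `|y|) / 2 by rewrite ge_min lexx.
have d2 : delta <= t - a by rewrite ge_min lexx orbT.
have yh : `|h2 + y| <= `|h2| + `|y| by exact: ler_normD.
have ah : a < t + h1.
  by move: h1d; rewrite ltr_norml => /andP[h1d _]; lra.
have y0 := normr_ge0 y.
(* [rho] has slope [r / a], which is at most [1]. *)
have rhoh : rho t - `|h1| <= rho (t + h1).
  have -> : rho (t + h1) = rho t + h1 * (r / a) by rewrite /rho; field;
    rewrite gt_eqF.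
  have ra1 : `|r / a| <= 1.
    by rewrite ger0_norm ?divr_ge0 ?(ltW r0) ?(ltW a0)// ler_pdivrMr// mul1r.
  have : `|h1 * (r / a)| <= `|h1| by rewrite normrM ler_piMr.
  rewrite ler_norml => /andP[h3 _]; lra.
have Im_small : `|h2 + y| <= rho t - `|h1| by lra.
have /= := HF ((t + h1) +i* (h2 + y)) ah (le_trans Im_small rhoh) x.
have -> : (t + h1) +i* (h2 + y) = h + z.
  by rewrite /h1 /h2 /t /y; case: (h) (z) => p q [p' q']; congr (_ +i* _);
    rewrite addrC.
have -> : h + 0 +i* y = 0 +i* (h2 + y) + h1%:C.
  by apply/eqP; rewrite eq_complex /h1 /h2; case: (h) => [? ?] /=;
    rewrite !addr0 add0r !eqxx.
have h1r : `|h1| < rho t by lra.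
have shift v : `|v| <= rho (t + h1) ->
    power_series (b (t + h1) x) v%:C @ \oo --> T (t + (h1 + v)) x.
  by move=> vr; rewrite addrA; apply: ((HBK _ ah).2 x).2.
apply: (recenter_real (fun v => T (t + v) x) _ _ _ _ _ _ _ ((HBK t az).2 x).1
  ((HBK _ ah).2 x).1 h1r (rho0 _ ah) ((HBK t az).2 x).2 shift _ _ _).1.
by rewrite rnorm_im.
Qed.
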